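(* Define $$f:\mathbb{R}^2\to\mathfrak{so}(3),\qquad f(x)=\rho_{J(x)}=\begin{bmatrix}0&0&x_1\\0&0&x_2\\-x_1&-x_2&0\end{bmatrix},\qquad x=(x_1,x_2).$$ Then the connection on $\mathbb{R}^2\times SO(3)$ associated to the rolling sphere is the pullback by $f$ of the natural connection on $\mathfrak{so}(3)\times SO(3)$.
   Context: For $v=(v_1,v_2,v_3)\in\mathbb{R}^3$ let $$\rho_v=\begin{bmatrix} 0 & -v_3 & v_2 \\ v_3 & 0 & -v_1 \\ -v_2 & v_1 & 0 \end{bmatrix}\in\mathfrak{so}(3).$$ $\mathbb{R}^2$ is embedded in $\mathbb{R}^3$ as $\{(x_1,x_2,0)\}$, and $J:\mathbb{R}^2\to\mathbb{R}^2$ is counterclockwise rotation by $\pi/2$, $J(x_1,x_2)=(-x_2,x_1)$. The connection associated to the rolling sphere (a unit sphere rolling without slipping on top of the plane) is the connection on the trivial right principal bundle $\mathbb{R}^2\times SO(3)\to\mathbb{R}^2$ (action $(x,h)\cdot g=(x,hg)$) with horizontal spaces $\{(v,\rho_{J(v)}g)\mid v\in\mathbb{R}^2\}\subset\mathbb{R}^2\times T_gSO(3)$ at $(x,g)$; its connection 1-form is $(v,\xi)\mapsto g^{-1}\xi-g^{-1}\rho_{J(v)}g$ at $(x,g)$. For a Lie group $G$ with Lie algebra $\mathfrak{g}$, the natural connection on the trivial right principal bundle $\mathfrak{g}\times G\to\mathfrak{g}$ has horizontal spaces $H_{(x,g)}=\{(v,T_1R_g(v))\mid v\in\mathfrak{g}\}$,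 where $R_g(h)=hg$. For $G=SO(3)$ its connection 1-form is $\alpha_{(x,g)}(v,\xi)=g^{-1}\xi-g^{-1}vg$ for $v\in\mathfrak{so}(3)$, $\xi\in T_gSO(3)$. The pullback of the natural connection by $f$ is the connection on $\mathbb{R}^2\times SO(3)$ with connection 1-form $\hat f^*\alpha$, where $\hat f:\mathbb{R}^2\times SO(3)\to\mathfrak{so}(3)\times SO(3)$, $\hat f(x,g)=(f(x),g)$. *)

(* Defs.v *)
From HB Require Import structures.
From mathcomp Require Import all_boot all_order all_algebra.
From mathcomp Require Import all_classical all_reals all_analysis.
Set Implicit Arguments.
Unset Strict Implicit.
Unset Printing Implicit Defensive.
Import Order.TTheory GRing.Theory Num.Theory.
Import numFieldNormedType.Exports.
Local Open Scope classical_set_scope.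
Local Open Scope ring_scope.

(* Manifolds are represented as subsets of an ambient finite-dimensional normed
   space: R^2 is [set: 'rV_2], so(3) and SO(3) are sets of 3 x 3 matrices. Maps
   and vector fields are given by globally defined ambient functions, of which
   only the restrictions to these subsets and to their tangent spaces matter. *)

Section Calculus.
Variable R : realType.

(* C^oo: every iterated directional derivative is differentiable everywhere. *)
Definition smooth (U W : normedModType R) (F : U -> W) : Prop :=
  forall (vs : seq U) (x : U), differentiable (foldr (fun v G => 'D_v G) F vs) x.

(* The tangent space at p of an embedded submanifold S: the velocities at p of
   the curves lying in S. *)
Definition tangent (U : normedModType R) (S : set U) (p : U) : set U :=
  [set w | exists c : R -> U,
     [/\ forall t, S (c t), c 0 = p & is_derive (0 : R) (1 : R) c w]].

(* The pullback F^* alpha of a vector-valued 1-form. *)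
Definition pullback_form (U U' W : normedModType R) (F : U -> U')
    (alpha : U' -> U' -> W) : U -> U -> W :=
  fun p w => alpha (F p) ('d F p w).

End Calculus.

Section Rotations.
Variable R : realType.

Definition mx_of_rows m n (s : seq (seq R)) : 'M[R]_(m, n) :=
  \matrix_(i < m, j < n) (nth [::] s i)`_j.

Definition rho (v : 'rV[R]_3) : 'M[R]_3 :=
  let v1 := v 0 0 in let v2 := v 0 1 in let v3 := v 0 2 in
  mx_of_rows 3 3 [:: [:: 0;     - v3; v2];
                     [:: v3;    0;    - v1];
                     [:: - v2;  v1;   0]].

Definition plane_in_space (x : 'rV[R]_2) : 'rV[R]_3 :=
  mx_of_rows 1 3 [:: [:: x 0 0; x 0 1; 0]].

Definition J (x : 'rV[R]_2) : 'rV[R]_2 :=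
  mx_of_rows 1 2 [:: [:: - x 0 1; x 0 0]].

Definition SO3 : set 'M[R]_3 := [set g | g^T *m g = 1%:M /\ \det g = 1].

Definition so3 : set 'M[R]_3 := [set A | A^T = - A].

End Rotations.

(* Principal connections on the trivial right principal bundle B x SO(3) -> B. *)
Section Connections.
Variables (R : realType) (V : normedModType R) (B : set V).

Definition total_space : set (V * 'M[R]_3) := B `*` @SO3 R.

Definition act (p : V * 'M[R]_3) (h : 'M[R]_3) : V * 'M[R]_3 := (p.1, p.2 *m h).

(* The value at p of the fundamental vector field of A in so(3), i.e. the
   derivative at the identity of the orbit map h |-> p h in the direction A;
   these vectors form the vertical space at p. *)
Definition fundamental (p : V * 'M[R]_3) (A : 'M[R]_3) : V * 'M[R]_3 :=
  'd (act p) (1%:M : 'M[R]_3) A.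

Definition distribution : Type := V * 'M[R]_3 -> set (V * 'M[R]_3).

Definition one_form : Type := V * 'M[R]_3 -> V * 'M[R]_3 -> 'M[R]_3.

(* Near every point of S, H is spanned by finitely many smooth vector fields. *)
Definition smooth_distribution (S : set (V * 'M[R]_3)) (H : distribution) : Prop :=
  forall p0, S p0 ->
    exists (n : nat) (X : 'I_n -> V * 'M[R]_3 -> V * 'M[R]_3),
      (forall i, smooth (X i)) /\
      \forall p \near p0, S p ->
        H p = [set \sum_(i < n) a i *: X i p | a in [set: 'I_n -> R]].

(* The second condition says that the tangent space is the direct sum of H p and
   the vertical space. *)
Definition is_connection (H : distribution) : Prop :=
  [/\ forall p, total_space p -> H p `<=` tangent total_space p,
      forall p w, total_space p -> tangent total_space p w ->
        exists! A : 'M[R]_3, @so3 R A /\ H p (w - fundamental p A),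
      forall p h, total_space p -> @SO3 R h ->
        H (act p h) = 'd (act ^~ h) p @` H p
    & smooth_distribution total_space H].

(* alpha is the connection 1-form of H: alpha p w is the element of so(3) whose
   fundamental vector at p is the vertical component of w. *)
Definition is_connection_form (H : distribution) (alpha : one_form) : Prop :=
  forall p w, total_space p -> tangent total_space p w ->
    @so3 R (alpha p w) /\ H p (w - fundamental p (alpha p w)).

End Connections.

Section RollingSphere.
Variable R : realType.

Definition rolling_horizontal : distribution 'rV[R]_2 :=
  fun p => [set (v, rho (plane_in_space (J v)) *m p.2) | v in [set: 'rV[R]_2]].

Definition rolling_form : one_form 'rV[R]_2 :=
  fun p w => invmx p.2 *m w.2
             - invmx p.2 *m rho (plane_in_space (J w.1)) *m p.2.

Definition right_translation (g h : 'M[R]_3) : 'M[R]_3 := h *m g.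

Definition natural_horizontal : distribution 'M[R]_3 :=
  fun p => [set (v, 'd (right_translation p.2) (1%:M : 'M[R]_3) v) | v in @so3 R].

Definition natural_form : one_form 'M[R]_3 :=
  fun p w => invmx p.2 *m w.2 - invmx p.2 *m w.1 *m p.2.

Definition f (x : 'rV[R]_2) : 'M[R]_3 := rho (plane_in_space (J x)).

Definition fhat (p : 'rV[R]_2 * 'M[R]_3) : 'M[R]_3 * 'M[R]_3 := (f p.1, p.2).

End RollingSphere.

(* Main.v *)
(* A matrix A in so(3) is realised as the velocity at g of a curve in SO(3) by
   the Cayley transform of tA, a curve rational in t, so no matrix exponential
   is needed. Conversely, differentiating g^T g = 1 shows that g^T w is skew for
   every w tangent to SO(3) at g. Both connections are instances of one: for a
   linear space B and a linear map phi from B to so(3), the horizontal vectors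
   at (x, g) are the (v, phi v g), with phi the identity for the natural
   connection and phi = f for the rolling sphere. *)
Require Import Defs.
From HB Require Import structures.
From mathcomp Require Import all_boot all_order all_algebra.
From mathcomp Require Import all_classical all_reals all_analysis.
From mathcomp Require Import ring lra.
Set Implicit Arguments.
Unset Strict Implicit.
Unset Printing Implicit Defensive.
Import Order.TTheory GRing.Theory Num.Theory.
Import numFieldNormedType.Exports.
Local Open Scope classical_set_scope.
Local Open Scope ring_scope.

(** * Calculus of linear and affine maps, and tangent vectors of products *)

Lemma mx_linear_continuous (R : realType) m n (W : normedModType R)
    (L : {linear 'M[R]_(m, n) -> W}) : continuous L.
Proof.
have E : (L : 'M[R]_(m, n) -> W) =
    \sum_i \sum_j (fun B : 'M[R]_(m, n) => B i j *: L (delta_mx i j)).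
  apply/funext => B; rewrite [B in LHS]matrix_sum_delta linear_sum fct_sumE.
  apply: eq_bigr => i _; rewrite linear_sum fct_sumE.
  by apply: eq_bigr => j _; rewrite linearZ.
move=> A; apply: (@differentiable_continuous _ _ _ A L); rewrite E.
apply: differentiable_sum => i; apply: differentiable_sum => j.
exact/differentiableZl/differentiable_coord.
Qed.

Lemma is_diff_linear (R : realType) (U W : normedModType R)
    (L : {linear U -> W}) (x : U) :
  continuous L -> is_diff x L L.
Proof.
by move=> Lc; apply: DiffDef; [exact: linear_differentiable | exact: diff_lin].
Qed.

Lemma is_diff_mx_linear (R : realType) m n (W : normedModType R)
    (L : {linear 'M[R]_(m, n) -> W}) (x : 'M[R]_(m, n)) : is_diff x L L.
Proof. exact/is_diff_linear/mx_linear_continuous. Qed.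

Lemma is_diff_fst (R : realType) (U V : normedModType R) (p : U * V) :
  is_diff p fst fst.
Proof. by apply: is_diff_linear => ?; exact: cvg_fst. Qed.

Lemma is_diff_snd (R : realType) (U V : normedModType R) (p : U * V) :
  is_diff p snd snd.
Proof. by apply: is_diff_linear => ?; exact: cvg_snd. Qed.

Lemma is_diff_affine (R : realType) (U W : normedModType R) (c : W)
    (L : {linear U -> W}) (x : U) :
  continuous L -> is_diff x (cst c + L) L.
Proof.
move=> Lc; have dL := is_diff_linear x Lc.
by apply: is_diff_eq; rewrite add0r.
Qed.

(** Continuous affine maps are stable under ['D_v], which sends [cst c + L] to the constant [L v].
    Hence every iterated derivative is again affine. *)
Lemma smooth_affine (R : realType) (U W : normedModType R) (c : W)
    (L : {linear U -> W}) :
  continuous L -> smooth (cst c + L).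
Proof.
move=> Lc vs x.
suff [c' [L' [-> L'c]]] : exists c' (L' : {linear U -> W}),
    foldr (fun v G => 'D_v G) (cst c + L) vs = cst c' + L' /\ continuous L'.
  by have := is_diff_affine c' x L'c; case.
elim: vs => [|v vs [c' [L' [E L'c]]]]; first by exists c, L.
exists (L' v), \0; split; last exact: cst_continuous.
apply/funext => y; rewrite /= E.
have d := is_diff_affine c' y L'c.
by rewrite deriveE // diff_val /= !fctE /= addr0.
Qed.

Lemma is_derive_linear (R : realType) (U W : normedModType R)
    (L : {linear U -> W}) (c : R -> U) (t : R) (w : U) :
  continuous L -> is_derive t 1 c w -> is_derive t 1 (L \o c) (L w).
Proof.
move=> Lc [/derivable1_diffP dc <-].
have dL : differentiable L (c t) by exact: linear_differentiable.
have dLc : differentiable (L \o c) t by exact: differentiable_comp.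
split; first exact/derivable1_diffP.
by rewrite !deriveE // diff_comp //= diff_lin.
Qed.

Lemma tangent_setX (R : realType) (U V : normedModType R) (A : set U)
    (B : set V) (p w : U * V) :
  tangent (A `*` B) p w <-> tangent A p.1 w.1 /\ tangent B p.2 w.2.
Proof.
split.
- move=> [c [cAB c0 dc]]; split.
    exists (fst \o c); split => [t||]; [by case: (cAB t) | by rewrite /= c0 |].
    by apply: (@is_derive_linear _ _ _ fst) => // x; exact: cvg_fst.
  exists (snd \o c); split => [t||]; [by case: (cAB t) | by rewrite /= c0 |].
  by apply: (@is_derive_linear _ _ _ snd) => // x; exact: cvg_snd.
- case: p w => [x y] [v w] [[c [cA /= c0 dc]] [d [dB /= d0 dd]]].
  exists (fun t => (c t, d t)); split => [t||]; last first.
  + case: dc dd => /derivable1_diffP dc <- [/derivable1_diffP dd <-].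
    split; first exact/derivable1_diffP/differentiable_pair.
    rewrite !deriveE ?diff_pair //; exact/differentiable_pair.
  + by rewrite c0 d0.
  + by split; [exact: cA | exact: dB].
Qed.

(** * Skew matrices, rotations and the tangent spaces of [SO3] *)

Lemma so3_rho (R : realType) (A : 'M[R]_3) : so3 A <-> exists v, A = rho v.
Proof.
split; last first.
  case=> v ->; apply/matrixP => -[[|[|[|//]]] i] -[[|[|[|//]]] j];
    by rewrite !mxE /= ?opprK ?oppr0.
move=> /matrixP A_skew; exists (mx_of_rows 1 3 [:: [:: A 2 1; A 0 2; A 1 0]]).
(* Indexing by naturals identifies entries whose ordinal indices differ only in their bound
   proofs. *)
pose F i j := A (inord i) (inord j).
have AF i j : A i j = F i j by rewrite /F !inord_val.
have F_skew i j : (i < 3)%N -> (j < 3)%N -> F i j = - F j i.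
  move=> i3 j3; have := A_skew (inord i) (inord j).
  by rewrite !mxE !AF !inordK // => ->; rewrite opprK.
have F_diag i : (i < 3)%N -> F i i = 0.
  by move=> i3; have := F_skew i i i3 i3; lra.
apply/matrixP => -[[|[|[|//]]] i] -[[|[|[|//]]] j]; rewrite !mxE /= !AF /=;
  by [exact: F_diag | exact: F_skew | exact: erefl].
Qed.

Lemma det_mx33 (R : comRingType) (A : 'M[R]_3) :
  \det A = A 0 0 * (A 1 1 * A 2 2 - A 1 2 * A 2 1)
         - A 0 1 * (A 1 0 * A 2 2 - A 1 2 * A 2 0)
         + A 0 2 * (A 1 0 * A 2 1 - A 1 1 * A 2 0).
Proof.
pose F i j := A (inord i) (inord j).
have AF i j : A i j = F i j by rewrite /F !inord_val.
rewrite (expand_det_row _ ord0) !big_ord_recl big_ord0 /cofactor.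
rewrite !(expand_det_row _ ord0) !big_ord_recl !big_ord0 /cofactor !det_mx11.
rewrite !mxE !AF /= /bump /=.
ring.
Qed.

(* As A^3 = - |v|^2 A for A = rho v, the hypothesis says exactly that
   (1 - a A + b A^2) (1 + a A + b A^2) = 1. *)
Lemma rodrigues_SO3 (R : realType) (v : 'rV[R]_3) (a b : R) :
  2 * b = a ^+ 2 + (v 0 0 ^+ 2 + v 0 1 ^+ 2 + v 0 2 ^+ 2) * b ^+ 2 ->
  SO3 (1%:M + a *: rho v + b *: (rho v *m rho v)).
Proof.
have -> : 1%:M + a *: rho v + b *: (rho v *m rho v) = mx_of_rows 3 3
  [:: [:: 1 - b * (v 0 1 ^+ 2 + v 0 2 ^+ 2); b * v 0 0 * v 0 1 - a * v 0 2;
          b * v 0 0 * v 0 2 + a * v 0 1];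
      [:: b * v 0 0 * v 0 1 + a * v 0 2; 1 - b * (v 0 0 ^+ 2 + v 0 2 ^+ 2);
          b * v 0 1 * v 0 2 - a * v 0 0];
      [:: b * v 0 0 * v 0 2 - a * v 0 1; b * v 0 1 * v 0 2 + a * v 0 0;
          1 - b * (v 0 0 ^+ 2 + v 0 1 ^+ 2)]].
  apply/matrixP => -[[|[|[|//]]] i] -[[|[|[|//]]] j];
  by rewrite !(mxE, big_ord_recl, big_ord0) /= /bump /=; ring.
move: (v 0 0) (v 0 1) (v 0 2) => x y z ab.
have a2 : a ^+ 2 = 2 * b - (x ^+ 2 + y ^+ 2 + z ^+ 2) * b ^+ 2 by lra.
split; last by rewrite det_mx33 !mxE /=; ring: a2.
apply/matrixP => -[[|[|[|//]]] i] -[[|[|[|//]]] j];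
  by rewrite !(mxE, big_ord_recl, big_ord0) /= /bump /=; ring: a2.
Qed.

Lemma is_derive_scalel (R : realType) (W : normedModType R) (a : R -> R)
    (t da : R) (w : W) :
  is_derive t 1 a da -> is_derive t 1 (fun u => a u *: w) (da *: w).
Proof.
case=> /derivable1_diffP ta <-; split.
  exact/derivable1_diffP/differentiableZl.
by rewrite !deriveE ?diffZl //; exact: differentiableZl.
Qed.

Lemma tangent_SO3 (R : realType) (g A : 'M[R]_3) :
  SO3 g -> so3 A -> tangent (@SO3 R) g (A *m g).
Proof.
move=> [g_orth g_det] /so3_rho [v ->].
set n2 : R := v 0 0 ^+ 2 + v 0 1 ^+ 2 + v 0 2 ^+ 2.
have n2_ge0 : 0 <= n2 by rewrite !addr_ge0 ?sqr_ge0.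
(* For [A = rho v] one has [A^3 = - n2 A], so the Cayley transform [(1 - tA/2)^-1 (1 + tA/2)] equals
   [1 + (t/d) A + (t^2/(2d)) A^2]. Since [d > 0], the curve is defined for all [t]. *)
pose d (t : R) : R := 1 + n2 / 4 * t ^+ 2.
have d_gt0 t : 0 < d t by rewrite ltr_pwDl // mulr_ge0 ?divr_ge0 ?sqr_ge0.
pose a : R -> R := id * (fun t => (d t)^-1).
pose b : R -> R := 2^-1 \*: (id * a).
have dd : derivable d 0 (1 : R).
  have -> : d = cst 1 + (n2 / 4) \*: (id ^+ 2) by [].
  by [].
(* Derivability suffices: in the product rule for [a] at 0, the derivative of this factor is
   multiplied by 0. *)
have ds : derivable (fun t => (d t)^-1) 0 (1 : R).
  by apply: derivableV => //; exact: lt0r_neq0.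
have da : is_derive (0 : R) 1 a 1.
  have ds' := derivableP ds.
  apply: is_derive_eq; rewrite scale0r add0r /d expr0n mulr0 addr0 invr1.
  by rewrite scale1r.
have a0 : a 0 = 0 by rewrite /a /= !fctE /= mul0r.
have b0 : b 0 = 0 by rewrite /b /= !fctE /= mul0r scaler0.
have db : is_derive (0 : R) 1 b 0.
  by apply: is_derive_eq; rewrite a0 !scale0r addr0 scaler0.
pose Q t := 1%:M + a t *: rho v + b t *: (rho v *m rho v).
have QE t : Q t *m g = g + a t *: (rho v *m g) + b t *: (rho v *m rho v *m g).
  by rewrite !mulmxDl mul1mx -!scalemxAl.
exists (fun t => Q t *m g); split.
- move=> t; have [Q_orth Q_det] : SO3 (Q t).
    apply: rodrigues_SO3; rewrite -/n2 /b /a /= !fctE /=.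
    rewrite [_ *: _]/GRing.scale /= /d; field.
    by rewrite lt0r_neq0 // ltr_pwDl // mulr_ge0 ?sqr_ge0.
  split; last by rewrite det_mulmx Q_det g_det mulr1.
  by rewrite trmx_mul mulmxA -(mulmxA g^T) Q_orth mulmx1.
- by rewrite QE a0 b0 !scale0r !addr0.
- have -> : (fun t => Q t *m g) = cst g + (fun t => a t *: (rho v *m g))
      + (fun t => b t *: (rho v *m rho v *m g)) by apply/funext => t; exact: QE.
  have dA := is_derive_scalel (rho v *m g) da.
  have dB := is_derive_scalel (rho v *m rho v *m g) db.
  have := is_deriveD (is_deriveD (is_derive_cst g (0 : R) (1 : R)) dA) dB.
  by rewrite scale1r scale0r add0r addr0.
Qed.

Lemma tangent_SO3_skew (R : realType) (g w : 'M[R]_3) :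
  tangent (@SO3 R) g w -> w^T *m g = - (g^T *m w).
Proof.
move=> [c [c_SO3 <- dc]]; apply/eqP; rewrite -addr_eq0; apply/eqP.
have dcoord k i : is_derive (0 : R) 1 (fun t => c t k i) (w k i).
  pose l (M : 'M[R]_3) : R := M k i.
  have l_lin : linear l by move=> ? ? ?; rewrite /l !mxE.
  pose lM := GRing.isLinear.Build _ _ _ _ _ l_lin.
  pose L : {linear 'M[R]_3 -> R} := HB.pack l lM.
  apply: (@is_derive_linear _ _ _ L) => //; exact: mx_linear_continuous.
apply/matrixP => i j; rewrite !mxE -big_split /=.
(* The [h k] are the summands of entry [(i, j)] of [c^T c]; their sum is constant, so the product
   rule gives the identity entrywise. *)
pose h (k : 'I_3) : R -> R := (fun t => c t k i) * (fun t => c t k j).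
have hE : \sum_k h k = cst ((1%:M : 'M[R]_3) i j).
  apply/funext => t; rewrite fct_sumE /cst; case: (c_SO3 t) => <- _.
  by rewrite mxE; apply: eq_bigr => k _; rewrite mxE.
have dh := is_derive_sum (fun k => is_deriveM (dcoord k i) (dcoord k j)).
have : 'D_1 (\sum_k h k) 0 = 0 by rewrite hE derive_cst.
rewrite /h (@derive_val _ _ _ _ _ _ _ dh) => dh0; rewrite -[RHS]dh0.
by apply: eq_bigr => k _; rewrite !mxE addrC [w k i * _]mulrC.
Qed.

(** * The connection defined by a linear map into [so3] *)

Section HorizontalDistribution.
Variables (R : realType) (V : normedModType R) (n : nat) (e : 'I_n -> V).
Variables (B : set V) (phi : {linear V -> 'M[R]_3}).
Hypothesis B_span : B = [set \sum_(i < n) a i *: e i | a in [set: 'I_n -> R]].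
Hypothesis tangentB : forall x w, B x -> tangent B x w -> B w.
Hypothesis phi_so3 : forall v, B v -> so3 (phi v).

Definition horizontal : Defs.distribution V :=
  fun p => [set (v, phi v *m p.2) | v in B].

Definition horizontal_form : Defs.one_form V :=
  fun p w => invmx p.2 *m w.2 - invmx p.2 *m phi w.1 *m p.2.

Lemma fundamentalE (p : V * 'M[R]_3) A : fundamental p A = (0, p.2 *m A).
Proof.
have d := is_diff_pair (is_diff_cst p.1 (1%:M : 'M[R]_3))
  (is_diff_mx_linear (mulmx p.2) 1%:M).
exact: (congr1 (fun D => D A) (@diff_val _ _ _ _ _ _ _ d)).
Qed.

Lemma diff_act (p w : V * 'M[R]_3) (h : 'M[R]_3) :
  'd (@act R V ^~ h) p w = (w.1, w.2 *m h).
Proof.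
have d := is_diff_pair (is_diff_fst p)
  (is_diff_comp (is_diff_snd p) (is_diff_mx_linear (mulmxr h) p.2)).
exact: (congr1 (fun D => D w) (@diff_val _ _ _ _ _ _ _ d)).
Qed.

Lemma subr_fundamental (p w : V * 'M[R]_3) A :
  w - fundamental p A = (w.1, w.2 - p.2 *m A).
Proof. by rewrite fundamentalE; case: w => v X; congr (_, _); exact: subr0. Qed.

(** At [(x, g)] the form is [g^-1 (w.2 - phi w.1 g)]. Since [g^-1 = g^T], it is a difference of two
    skew matrices, [g^T w.2] and [g^T (phi w.1) g]. Subtracting [g] times it from [w.2] leaves
    [phi w.1 g]. *)
Lemma horizontal_form_connection :
  is_connection_form B horizontal horizontal_form.
Proof.
move=> p w [Bp [p_orth p_det]] /tangent_setX [Bw tan_w].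
have p_unit : p.2 \in unitmx by case/mulmx1_unit: p_orth.
have p_inv : invmx p.2 = p.2^T.
  by rewrite -[LHS]mul1mx -p_orth -mulmxA mulmxV ?mulmx1.
have {}Bw : B w.1 by exact: tangentB Bw.
split.
- rewrite /so3 /= /horizontal_form p_inv linearB /= !trmx_mul trmxK.
  rewrite (tangent_SO3_skew tan_w) (phi_so3 Bw) mulNmx mulmxN mulmxA.
  by rewrite opprK opprB addrC.
- rewrite subr_fundamental; exists w.1 => //; congr (_, _).
  by rewrite /horizontal_form mulmxBr !mulmxA mulmxV // !mul1mx subKr.
Qed.

Lemma smooth_horizontal_field (v : V) (A : 'M[R]_3) :
  smooth (fun p : V * 'M[R]_3 => (v, A *m p.2)).
Proof.
pose l (p : V * 'M[R]_3) : V * 'M[R]_3 := (0, A *m p.2).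
have l_lin : linear l.
  move=> a p q; congr (_, _); first by rewrite /= scaler0 addr0.
  by rewrite /= mulmxDr -scalemxAr.
pose lM := GRing.isLinear.Build _ _ _ _ _ l_lin.
pose L : {linear (V * 'M[R]_3)%type -> (V * 'M[R]_3)%type} := HB.pack l lM.
have -> : (fun p : V * 'M[R]_3 => (v, A *m p.2)) = cst (v, 0) + L.
  by apply/funext => p; rewrite -[v in LHS]addr0 -[A *m _]add0r.
apply: smooth_affine => p; apply: (@differentiable_continuous _ _ _ p L).
apply: differentiable_pair; first exact: differentiable_cst.
by have [] := is_diff_comp (is_diff_snd p) (is_diff_mx_linear (mulmx A) p.2).
Qed.

(** Tangency comes from a straight line in [B] paired with a curve in [SO3]. Equivariance holds
    because left multiplication by [phi v] commutes with right multiplication by [h]. *)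
Lemma horizontal_connection : is_connection B horizontal.
Proof.
split.
- move=> p [Bp p_SO3] _ [v Bv <-]; apply/tangent_setX; split; last first.
    by apply: tangent_SO3 => //; exact: phi_so3.
  exists (cst p.1 + (fun t => t *: v)); split.
  + move=> t; move: Bp Bv; rewrite B_span => -[a _ <-] [b _ <-].
    exists (fun i => a i + t * b i) => //.
    rewrite !fctE scaler_sumr -big_split /=.
    by apply: eq_bigr => i _; rewrite scalerDl scalerA.
  + by rewrite /= !fctE scale0r addr0.
  + have := is_derive_scalel v (is_derive_id (0 : R) (1 : R)).
    move=> /(is_deriveD (is_derive_cst p.1 (0 : R) (1 : R))).
    by rewrite scale1r add0r.
- move=> p w pT wT; have [A_so3 A_hor] := horizontal_form_connection pT wT.
  exists (horizontal_form p w); split=> // A [_ [v Bv]].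
  rewrite subr_fundamental => -[-> E].
  (* Uniqueness: horizontality determines [p.2 *m A], and [p.2] is invertible. *)
  case: pT => _ [/mulmx1_unit[_ p_unit] _].
  by rewrite /horizontal_form -!mulmxA E -mulmxBr subKr mulmxA mulVmx // mul1mx.
- move=> p h [Bp p_SO3] h_SO3; apply/seteqP; split => [w [v Bv <-]|].
    exists (v, phi v *m p.2); first by exists v.
    by rewrite diff_act mulmxA.
  by move=> _ [_ [v Bv <-] <-]; exists v; rewrite // diff_act mulmxA.
- move=> p0 _; exists n, (fun i p => (e i, phi (e i) *m p.2)); split.
    by move=> i; exact: smooth_horizontal_field.
  apply: filterE => p _.
  (* By linearity of [phi], the fields attached to the [e i] form a global spanning family. *)
  have spanE (a : 'I_n -> R) : \sum_i a i *: (e i, phi (e i) *m p.2)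
     = (\sum_i a i *: e i, phi (\sum_i a i *: e i) *m p.2).
    rewrite linear_sum mulmx_suml.
    apply: (big_ind3 (fun (x : V * 'M[R]_3) y z => x = (y, z))) => //.
      by move=> _ x1 x2 _ y1 y2 -> ->.
    by move=> i _; rewrite linearZ -scalemxAl.
  rewrite /horizontal B_span; apply/seteqP; split => [_ [_ [a _ <-] <-]|].
    by exists a.
  by move=> _ [a _ <-]; exists (\sum_i a i *: e i); [exists a | rewrite spanE].
Qed.

End HorizontalDistribution.

(** * The natural and rolling connections as instances, and the pullback *)

Lemma linear_rho (R : realType) : linear (@rho R).
Proof.
move=> a u v; apply/matrixP => -[[|[|[|//]]] i] -[[|[|[|//]]] j];
  rewrite !mxE /= ?mxE; ring.
Qed.

HB.instance Definition _ (R : realType) :=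
  GRing.isLinear.Build _ _ _ _ (@rho R) (@linear_rho R).

Lemma so3_span (R : realType) :
  @so3 R = [set \sum_(i < 3) a i *: rho (delta_mx 0 i)
           | a in [set: 'I_3 -> R]].
Proof.
have rho_span (a : 'I_3 -> R) :
    \sum_i a i *: rho (delta_mx 0 i) = rho (\row_i a i).
  rewrite [X in rho X]row_sum_delta linear_sum.
  by apply: eq_bigr => i _; rewrite linearZ mxE.
apply/seteqP; split => [A /so3_rho [v ->]|_ [a _ <-]].
  exists (v 0) => //; rewrite rho_span; congr rho.
  by apply/rowP => i; rewrite mxE.
by apply/so3_rho; exists (\row_i a i).
Qed.

(** [so3] is the kernel of the linear map [M |-> M^T + M], which therefore also kills velocities of
    curves in [so3]. *)
Lemma tangent_so3 (R : realType) (A w : 'M[R]_3) :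
  tangent (@so3 R) A w -> so3 w.
Proof.
move=> [c [c_so3 _ dc]].
pose l (M : 'M[R]_3) := M^T + M.
have l_lin : linear l by move=> ? ? ?; rewrite /l !linearP scalerDr addrACA.
pose lM := GRing.isLinear.Build _ _ _ _ _ l_lin.
pose L : {linear 'M[R]_3 -> 'M[R]_3} := HB.pack l lM.
have := is_derive_linear (@mx_linear_continuous _ _ _ _ L) dc.
have -> : L \o c = cst 0.
  by apply/funext => t; rewrite /= /l (c_so3 t) addNr.
move=> /(@derive_val _ _ _ _ _ _ _); rewrite derive_cst => /esym /eqP.
by rewrite addr_eq0 => /eqP.
Qed.

Lemma rolling_mapE (R : realType) (x : 'rV[R]_2) :
  f x = mx_of_rows 3 3 [:: [:: 0;         0;         x 0 0];
                           [:: 0;         0;         x 0 1];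
                           [:: - x 0 0;   - x 0 1;   0]].
Proof.
apply/matrixP => -[[|[|[|//]]] i] -[[|[|[|//]]] j];
  by rewrite !(mxE, oppr0, opprK).
Qed.

Lemma linear_rolling_map (R : realType) : linear (@f R).
Proof.
move=> a x y; rewrite !rolling_mapE.
apply/matrixP => -[[|[|[|//]]] i] -[[|[|[|//]]] j];
  rewrite !mxE /= ?mxE; ring.
Qed.

HB.instance Definition _ (R : realType) :=
  GRing.isLinear.Build _ _ _ _ (@f R) (@linear_rolling_map R).

Lemma rolling_map_so3 (R : realType) (x : 'rV[R]_2) : so3 (f x).
Proof. by apply/so3_rho; eexists. Qed.

(** Right translation is linear, hence its own differential. *)
Lemma natural_horizontalE (R : realType) :
  @natural_horizontal R = horizontal (@so3 R) idfun.
Proof.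
apply/funext => p; rewrite /natural_horizontal.
have d := is_diff_mx_linear (mulmxr p.2) (1%:M : 'M[R]_3).
rewrite (_ : 'd _ _ = mulmxr p.2 :> (_ -> _)) //.
exact: (@diff_val _ _ _ _ _ _ _ d).
Qed.

(** As [fhat] is linear, its differential sends [(v, xi)] to [(f v, xi)]; substituting this in
    [natural_form] gives [rolling_form] on all ambient vectors. *)
Lemma pullback_natural_form (R : realType) :
  pullback_form (@fhat R) (@natural_form R) = @rolling_form R.
Proof.
apply/funext => p; apply/funext => w; rewrite /pullback_form /natural_form.
have d := is_diff_pair
  (is_diff_comp (is_diff_fst p) (is_diff_mx_linear (@f R) p.1)) (is_diff_snd p).
by rewrite [X in X w](@diff_val _ _ _ _ _ _ _ d).
Qed.

Theorem theorem12 (R : realType) :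
  (* f is the given smooth map from R^2 to so(3) *)
  (forall x : 'rV[R]_2,
     so3 (f x) /\
     f x = mx_of_rows 3 3 [:: [:: 0;         0;         x 0 0];
                              [:: 0;         0;         x 0 1];
                              [:: - x 0 0;   - x 0 1;   0]]) /\
  smooth (@f R) /\
  (* the natural connection and its connection 1-form *)
  is_connection (@so3 R) (@natural_horizontal R) /\
  is_connection_form (@so3 R) (@natural_horizontal R) (@natural_form R) /\
  (* the connection of the rolling sphere and its connection 1-form *)
  is_connection [set: 'rV[R]_2] (@rolling_horizontal R) /\
  is_connection_form [set: 'rV[R]_2] (@rolling_horizontal R) (@rolling_form R) /\
  (* the latter connection is the pullback of the former by f *)
  is_connection_form [set: 'rV[R]_2] (@rolling_horizontal R)
    (pullback_form (@fhat R) (@natural_form R)) /\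
  (forall p w, total_space [set: 'rV[R]_2] p ->
     tangent (total_space [set: 'rV[R]_2]) p w ->
     rolling_form p w = pullback_form (@fhat R) (@natural_form R) p w).
Proof.
have so3_tan (A w : 'M[R]_3) (_ : so3 A) := @tangent_so3 R A w.
have plane_span : [set: 'rV[R]_2]
    = [set \sum_(i < 2) a i *: delta_mx 0 i | a in [set: 'I_2 -> R]].
  apply/seteqP; split=> // y _; exists (y 0) => //.
  by rewrite [RHS]row_sum_delta.
have plane_tan (x w : 'rV[R]_2) (_ : [set: 'rV[R]_2] x)
  (_ : tangent [set: 'rV[R]_2] x w) : [set: 'rV[R]_2] w by [].
have f_so3 (x : 'rV[R]_2) (_ : [set: 'rV[R]_2] x) := rolling_map_so3 x.
have id_so3 (A : 'M[R]_3) (h : so3 A) : so3 (idfun A) := h.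
(* The rolling data are, by conversion, [horizontal] and [horizontal_form] with [phi = f]. *)
have rolling_conn :
    is_connection_form [set: 'rV[R]_2]
      (@rolling_horizontal R) (@rolling_form R).
  exact: (horizontal_form_connection plane_tan f_so3).
(* The two pullback claims become [rolling_conn] and a reflexive equality. *)
rewrite pullback_natural_form natural_horizontalE.
split; first by move=> x; split; [exact: rolling_map_so3 | exact: rolling_mapE].
split.
  have -> : @f R = cst 0 + @f R by apply/funext => x; rewrite !fctE add0r.
  by apply: smooth_affine; exact: mx_linear_continuous.
split; first exact: (horizontal_connection (@so3_span R) so3_tan id_so3).
split; first exact: (horizontal_form_connection so3_tan id_so3).
split; first exact: (horizontal_connection plane_span plane_tan f_so3).
by do 2!split=> //.
Qed.
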